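(* Let $\mathcal{S}^{n-1}_n\subset\mathcal{C}^{\binom{n+1}{2}}$ be the variety of symmetric singular $n\times n$ matrices over $\mathcal{C}$. Then its real and complex tropicalizations coincide: $$\mathrm{trop}_{\mathcal{R}}(\mathcal{S}^{n-1}_n)=\mathrm{trop}_{\mathcal{C}}(\mathcal{S}^{n-1}_n).$$
   Context: Let $\mathcal{C}=\mathbb{C}\{\!\{t\}\!\}$ and $\mathcal{R}=\mathbb{R}\{\!\{t\}\!\}$ be the fields of complex and real Puiseux series, with valuation $\mathrm{val}(a)$ = the exponent of the lowest degree term of $a\ne0$. For a variety $X\subset\mathcal{C}^N$ and $\mathcal{K}\in\{\mathcal{C},\mathcal{R}\}$, let $\mathrm{trop}_{\mathcal{K}}(X)=\overline{\{\mathrm{val}(x): x\in X\cap(\mathcal{K}^* )^N\}}\subset\mathbb{R}^N$, with coordinatewise valuation and Euclidean closure. The coordinates on the space of symmetric matrices are the entries on and above the diagonal. *)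

(* Defs.v *)
From HB Require Import structures.
From mathcomp Require Import all_boot all_order all_algebra.
From mathcomp Require Import zify ring.
From mathcomp Require Import complex.
From mathcomp Require Import boolp classical_sets functions cardinality fsbigop.
From mathcomp Require Import reals topology normedtype.

Set Implicit Arguments.
Unset Strict Implicit.
Unset Printing Implicit Defensive.
Import Order.TTheory GRing.Theory Num.Theory.
Import numFieldNormedType.Exports.
Local Open Scope classical_set_scope.
Local Open Scope ring_scope.

(* A family [f : rat -> K] stands for the formal sum of the f q t^q; it is a
   Puiseux series when the q with f q != 0 have a common denominator and are
   bounded below. *)
Definition is_puiseux (K : fieldType) (f : rat -> K) : Prop :=
  exists (N : nat) (m : int), (0 < N)%N /\
    forall q : rat, f q != 0 -> exists k : int, m <= k /\ q = k%:~R / N%:R.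

Record puiseux (K : fieldType) := Puiseux {
  pcoef :> rat -> K;
  pcoefP : `[< is_puiseux pcoef >] }.

HB.instance Definition _ (K : fieldType) := [isSub for @pcoef K].
HB.instance Definition _ (K : fieldType) := [Choice of puiseux K by <:].

Lemma puiseuxP (K : fieldType) (a b : puiseux K) : (forall q, a q = b q) -> a = b.
Proof. by move=> ab; apply/val_inj/funext. Qed.

Section PuiseuxField.
Variable K : fieldType.
Implicit Types (f g h : rat -> K) (N : nat) (m : int).

(* For Puiseux series f and g only finitely many terms are nonzero. *)
Definition pconv f g : rat -> K :=
  fun q => \sum_(r \in [set: rat]) f r * g (q - r).

(* The exponents (k - m) / N, for k : nat, are those of t^(-m/N) K[[t^(1/N)]]. *)
Definition pexp N m (k : nat) : rat := (k%:Z - m)%:~R / N%:R.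

Definition psupp N m f := forall q, f q != 0 -> exists k : nat, q = pexp N m k.

Lemma psupp_puiseux N m f : (0 < N)%N -> psupp N m f -> is_puiseux f.
Proof.
move=> N0 sf; exists N, (- m); split=> // q /sf[k ->]; exists (k%:Z - m).
by split=> //; lia.
Qed.

Lemma psuppD N m d f : psupp N m f -> psupp N (m + d%:Z) f.
Proof.
move=> sf q /sf[k ->]; exists (k + d)%N; rewrite /pexp PoszD.
by congr (_%:~R / _); rewrite opprD addrACA subrr addr0.
Qed.

Lemma psuppM N m d f : (0 < d)%N -> psupp N m f -> psupp (N * d) (m * d%:Z) f.
Proof.
move=> d0 sf q /sf[k ->]; exists (k * d)%N; rewrite /pexp PoszM -mulrBl.
rewrite intrM natrM -[d%:~R]/(d%:R) invfM mulrACA divff ?mulr1//.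
by rewrite pnatr_eq0 -lt0n.
Qed.

Lemma puiseux_psupp f : is_puiseux f -> exists N (m : nat), (0 < N)%N /\ psupp N m f.
Proof.
move=> [N [m [N0 sf]]]; exists N, `|m|%N; split=> // q /sf[k [mk ->]].
exists (absz (k + `|m|%N)); rewrite /pexp; congr (_%:~R / _); lia.
Qed.

Lemma psupp_common N1 (m1 : nat) N2 (m2 : nat) f g :
  (0 < N1)%N -> (0 < N2)%N -> psupp N1 m1 f -> psupp N2 m2 g ->
  psupp (N1 * N2) (m1 * N2 + m2 * N1)%N f /\ psupp (N1 * N2) (m1 * N2 + m2 * N1)%N g.
Proof.
move=> N10 N20 sf sg; split; rewrite PoszD.
  by apply: psuppD; rewrite PoszM; exact: psuppM.
by rewrite addrC mulnC; apply: psuppD; rewrite PoszM; exact: psuppM.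
Qed.

Lemma puiseux_psupp2 f g : is_puiseux f -> is_puiseux g ->
  exists N (m : nat), [/\ (0 < N)%N, psupp N m f & psupp N m g].
Proof.
move=> /puiseux_psupp[N1 [m1 [N10 sf]]] /puiseux_psupp[N2 [m2 [N20 sg]]].
exists (N1 * N2)%N, (m1 * N2 + m2 * N1)%N.
by rewrite muln_gt0 N10 N20; case: (psupp_common N10 N20 sf sg).
Qed.

Lemma puiseux_psupp3 f g h : is_puiseux f -> is_puiseux g -> is_puiseux h ->
  exists N (m : nat), [/\ (0 < N)%N, psupp N m f, psupp N m g & psupp N m h].
Proof.
move=> /puiseux_psupp2 pf /pf {pf}[N1 [m1 [N10 sf sg]]].
move=> /puiseux_psupp[N2 [m2 [N20 sh]]].
exists (N1 * N2)%N, (m1 * N2 + m2 * N1)%N.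
rewrite muln_gt0 N10 N20.
by case: (psupp_common N10 N20 sf sh); case: (psupp_common N10 N20 sg sh).
Qed.

Lemma psupp_ext N m f g : psupp N m f -> psupp N m g ->
  (forall k, f (pexp N m k) = g (pexp N m k)) -> f = g.
Proof.
move=> sf sg fg; apply/funext => q.
have [/sf[k ->]//|/negPn/eqP f0] := boolP (f q != 0).
have [/sg[k ->]//|/negPn/eqP g0] := boolP (g q != 0); by rewrite f0 g0.
Qed.

Lemma pexp_inj N m : (0 < N)%N -> injective (pexp N m).
Proof.
move=> N0 i j /eqP; rewrite /pexp (inj_eq (mulIf _)); last first.
  by rewrite invr_eq0 pnatr_eq0 -lt0n.
by rewrite eqr_int (inj_eq (addIr _)) => /eqP[].
Qed.

Lemma pexpB N m m' k i : (i <= k)%N ->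
  pexp N (m + m') k - pexp N m i = pexp N m' (k - i).
Proof.
move=> ik; rewrite /pexp -mulrBl -intrB; congr (_%:~R / _); lia.
Qed.

Lemma pconv_coef N m m' f g k : (0 < N)%N -> psupp N m f -> psupp N m' g ->
  pconv f g (pexp N (m + m') k)
  = \sum_(i < k.+1) f (pexp N m i) * g (pexp N m' (k - i)).
Proof.
move=> N0 sf sg; rewrite /pconv.
rewrite (fsbigE [seq pexp N m i | i <- iota 0 k.+1]) //.
- rewrite big_mkcond big_map -(big_mkord xpredT (fun i =>
    f (pexp N m i) * g (pexp N m' (k - i)))) /index_iota subn0.
  apply: eq_big_seq => i; rewrite mem_iota add0n ltnS => /andP[_ ik].
  by rewrite mem_set// pexpB.
- by rewrite map_inj_uniq ?iota_uniq//; exact: pexp_inj.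
- move=> q _ qk; apply/eqP/negP => /negP; rewrite mulf_eq0 negb_or.
  move=> /andP[/sf[i qi] /sg[j]]; rewrite qi => /esym/eqP.
  rewrite /pexp -mulrBl -intrB (inj_eq (mulIf _)); last first.
    by rewrite invr_eq0 pnatr_eq0 -lt0n.
  rewrite eqr_int => /eqP e.
  have kij : k = (i + j)%N by lia.
  by move: qk; rewrite qi map_f// mem_iota add0n ltnS kij leq_addr.
Qed.


Lemma pconv_psupp N m m' f g : psupp N m f -> psupp N m' g ->
  psupp N (m + m') (pconv f g).
Proof.
move=> sf sg q fgq.
have [r fgr] : exists r, f r * g (q - r) != 0.
  apply: contrapT => /forallNP fg0; move/eqP: fgq; apply.
  by apply: fsbig1 => r _; apply/eqP/negPn/negP; exact: fg0.
move: fgr; rewrite mulf_eq0 negb_or => /andP[/sf[i ri] /sg[j]].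
move=> /eqP; rewrite subr_eq => /eqP ->; exists (i + j)%N.
by rewrite ri /pexp -mulrDl -intrD; congr (_%:~R / _); lia.
Qed.

Lemma pconv_puiseux f g : is_puiseux f -> is_puiseux g -> is_puiseux (pconv f g).
Proof.
move=> pf /(puiseux_psupp2 pf)[N [m [N0 sf sg]]].
exact: psupp_puiseux N0 (pconv_psupp sf sg).
Qed.

(* Truncations turn convolution into multiplication of polynomials. *)
Definition ptrunc N m L f : {poly K} := \poly_(i < L) f (pexp N m i).

Lemma pconv_trunc N m m' L f g k : (0 < N)%N -> psupp N m f -> psupp N m' g ->
  (k < L)%N ->
  pconv f g (pexp N (m + m') k) = (ptrunc N m L f * ptrunc N m' L g)`_k.
Proof.
move=> N0 sf sg kL; rewrite pconv_coef// coefM; apply: eq_bigr => i _.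
have iL : (i < L)%N by have := ltn_ord i; lia.
by rewrite !coef_poly iL (leq_ltn_trans (leq_subr _ _) kL).
Qed.

Lemma pconvA f g h : is_puiseux f -> is_puiseux g -> is_puiseux h ->
  pconv f (pconv g h) = pconv (pconv f g) h.
Proof.
move=> pf pg ph; have [N [m [N0 sf sg sh]]] := puiseux_psupp3 pf pg ph.
apply: (@psupp_ext N (m%:Z + (m%:Z + m%:Z))).
- exact: pconv_psupp sf (pconv_psupp sg sh).
- by rewrite addrA; exact: pconv_psupp (pconv_psupp sf sg) sh.
move=> k; transitivity
  ((ptrunc N m k.+1 f * (ptrunc N m k.+1 g * ptrunc N m k.+1 h))`_k).
  rewrite pconv_coef//; last exact: pconv_psupp.
  rewrite coefM; apply: eq_bigr => i _.
  by rewrite (pconv_trunc N0 sg sh (L := k.+1)) ?coef_poly ?ltn_ord// ltnS leq_subr.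
rewrite addrA pconv_coef//; last exact: pconv_psupp.
rewrite mulrA coefM; apply: eq_bigr => i _.
by rewrite (pconv_trunc N0 sf sg (L := k.+1)) ?coef_poly ?ltn_ord// ltnS leq_subr.
Qed.

Lemma pconvC f g : is_puiseux f -> is_puiseux g -> pconv f g = pconv g f.
Proof.
move=> pf /(puiseux_psupp2 pf)[N [m [N0 sf sg]]].
apply: (@psupp_ext N (m%:Z + m%:Z)); [exact: pconv_psupp..|move=> k].
rewrite (pconv_trunc N0 sf sg (ltnSn k)) mulrC.
by rewrite (pconv_trunc N0 sg sf (ltnSn k)).
Qed.

Lemma pconvDl f g h : is_puiseux f -> is_puiseux g -> is_puiseux h ->
  pconv (f \+ g) h = pconv f h \+ pconv g h.
Proof.
move=> pf pg ph; have [N [m [N0 sf sg sh]]] := puiseux_psupp3 pf pg ph.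
have sfg : psupp N m (f \+ g).
  move=> q /=; have [/sf//|/negPn/eqP->] := boolP (f q != 0).
  by rewrite add0r => /sg.
apply: (@psupp_ext N (m%:Z + m%:Z)); first exact: pconv_psupp.
  move=> q /=; have [/(pconv_psupp sf sh)//|/negPn/eqP->] := boolP (pconv f h q != 0).
  by rewrite add0r => /(pconv_psupp sg sh).
move=> k /=; rewrite !pconv_coef// -big_split; apply: eq_bigr => i _.
by rewrite mulrDl.
Qed.

Definition pone : rat -> K := fun q => (q == 0)%:R.

Lemma pone_psupp N : (0 < N)%N -> psupp N 0 pone.
Proof.
move=> N0 q; rewrite /pone; have [->|] := eqVneq q 0; last by rewrite eqxx.
by exists 0%N; rewrite /pexp subrr mul0r.
Qed.

Lemma pone_pexp N k : (0 < N)%N -> pone (pexp N 0 k) = (k == 0%N)%:R.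
Proof.
move=> N0; have p0 : pexp N 0 0 = 0 by rewrite /pexp subrr mul0r.
by rewrite /pone -[X in _ == X]p0 (inj_eq (pexp_inj (m := 0) N0)).
Qed.

Lemma pconv1 f : is_puiseux f -> pconv pone f = f.
Proof.
move=> pf; apply/funext => q; rewrite /pconv (fsbigE [:: 0])//.
  by rewrite big_cons big_nil mem_set// /pone eqxx mul1r subr0 [LHS]addr0.
by move=> r _; rewrite inE /pone => /negbTE ->; rewrite mul0r.
Qed.

Lemma padd_puiseux f g : is_puiseux f -> is_puiseux g -> is_puiseux (f \+ g).
Proof.
move=> pf /(puiseux_psupp2 pf)[N [m [N0 sf sg]]].
apply: (@psupp_puiseux N m) => // q /=.
have [/sf//|/negPn/eqP->] := boolP (f q != 0); by rewrite add0r => /sg.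
Qed.

Lemma popp_puiseux f : is_puiseux f -> is_puiseux (fun q => - f q).
Proof.
by move=> [N [m [N0 sf]]]; exists N, m; split=> // q; rewrite oppr_eq0 => /sf.
Qed.

Lemma p0_puiseux : is_puiseux (fun=> 0 : K).
Proof. by exists 1%N, 0; split=> // q; rewrite eqxx. Qed.

Definition mkPuiseux f (Pf : is_puiseux f) : puiseux K := Puiseux (asboolT Pf).

Lemma series_puiseux (a : puiseux K) : is_puiseux a. Proof. exact/asboolP/pcoefP. Qed.

Definition padd (a b : puiseux K) :=
  mkPuiseux (padd_puiseux (series_puiseux a) (series_puiseux b)).
Definition popp (a : puiseux K) := mkPuiseux (popp_puiseux (series_puiseux a)).
Definition pzero := mkPuiseux p0_puiseux.
Definition pmul (a b : puiseux K) :=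
  mkPuiseux (pconv_puiseux (series_puiseux a) (series_puiseux b)).
Definition pone_series :=
  mkPuiseux (psupp_puiseux (ltn0Sn 0) (pone_psupp (ltn0Sn 0))).

Lemma paddA : associative padd.
Proof. by move=> a b c; apply: puiseuxP => q /=; rewrite addrA. Qed.
Lemma paddC : commutative padd.
Proof. by move=> a b; apply: puiseuxP => q /=; rewrite addrC. Qed.
Lemma padd0 : left_id pzero padd.
Proof. by move=> a; apply: puiseuxP => q /=; rewrite add0r. Qed.
Lemma paddN : left_inverse pzero popp padd.
Proof. by move=> a; apply: puiseuxP => q /=; rewrite addNr. Qed.

HB.instance Definition _ := GRing.isZmodule.Build (puiseux K) paddA paddC padd0 paddN.

Lemma pmulA : associative pmul.
Proof. by move=> a b c; apply: puiseuxP => q /=; rewrite pconvA//; exact: series_puiseux. Qed.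
Lemma pmulC : commutative pmul.
Proof. by move=> a b; apply: puiseuxP => q /=; rewrite pconvC//; exact: series_puiseux. Qed.
Lemma pmul1 : left_id pone_series pmul.
Proof. by move=> a; apply: puiseuxP => q /=; rewrite pconv1//; exact: series_puiseux. Qed.
Lemma pmulDl : left_distributive pmul +%R.
Proof. by move=> a b c; apply: puiseuxP => q /=; rewrite pconvDl//; exact: series_puiseux. Qed.
Lemma pone_series_neq0 : pone_series != 0.
Proof.
apply/eqP => /(congr1 (fun a : puiseux K => a 0)) /=.
by rewrite /pone eqxx => /eqP; rewrite oner_eq0.
Qed.

HB.instance Definition _ :=
  GRing.Zmodule_isComNzRing.Build (puiseux K) pmulA pmulC pmul1 pmulDl pone_series_neq0.

(* The first k coefficients of the inverse of the power series with
   coefficients F. *)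
Fixpoint inv_coefs (F : nat -> K) (k : nat) : seq K :=
  if k is k'.+1 then
    let s := inv_coefs F k' in
    rcons s (((k' == 0%N)%:R - \sum_(i < k') s`_i * F (k' - i)%N) / F 0%N)
  else [::].

Lemma size_inv_coefs F k : size (inv_coefs F k) = k.
Proof. by elim: k => //= k IH; rewrite size_rcons IH. Qed.

Lemma nth_inv_coefs F k i : (i < k)%N -> (inv_coefs F k)`_i = (inv_coefs F i.+1)`_i.
Proof.
elim: k => // k IH; rewrite ltnS leq_eqVlt => /predU1P[->//|ik].
by rewrite [LHS]/= nth_rcons size_inv_coefs ik IH.
Qed.

Lemma inv_coefsP F k : F 0%N != 0 ->
  \sum_(i < k.+1) (inv_coefs F i.+1)`_i * F (k - i)%N = (k == 0%N)%:R.
Proof.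
move=> F0; rewrite big_ord_recr/= subnn nth_rcons size_inv_coefs ltnn eqxx.
rewrite divfK// -[X in _ + (_ - X)](_ : \sum_(i < k) (inv_coefs F i.+1)`_i * F (k - i)%N = _).
  by rewrite addrC subrK.
by apply: eq_bigr => i _; rewrite [in RHS]nth_inv_coefs.
Qed.

Lemma pinv_exists (a : puiseux K) : a != 0 -> exists b : puiseux K, b * a = 1.
Proof.
move=> a0; have [N [m [N0 sa]]] := puiseux_psupp (series_puiseux a).
have exk : exists k, a (pexp N m k) != 0.
  apply: contrapT => /forallNP ak; move/eqP: a0; apply; apply: puiseuxP => q /=.
  by apply/eqP/negPn/negP => aq; have [k qk] := sa _ aq; apply: (ak k); rewrite -qk.
case: (ex_minnP exk) => k0 ak0 mink0.
pose m' := m%:Z - k0%:Z.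
have pexpE k : pexp N m' k = pexp N m (k + k0)%N.
  by rewrite /pexp /m'; congr (_%:~R / _); lia.
have sa' : psupp N m' a.
  move=> q aq; have [k qk] := sa q aq; exists (k - k0)%N.
  by rewrite pexpE subnK// mink0// -qk.
pose F k := a (pexp N m' k).
have F0 : F 0%N != 0 by rewrite /F pexpE.
pose g q := if pselect (exists k, q = pexp N (- m') k) is left e
            then (inv_coefs F (projT1 (cid e)).+1)`_(projT1 (cid e)) else 0.
have gE k : g (pexp N (- m') k) = (inv_coefs F k.+1)`_k.
  rewrite /g; case: pselect => [e|[]]; last by exists k.
  by case: (cid e) => j /= /(pexp_inj N0) ->.
have sg : psupp N (- m') g by move=> q; rewrite /g; case: pselect; rewrite ?eqxx.
exists (mkPuiseux (psupp_puiseux N0 sg)); apply: val_inj => /=.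
have s1 := pconv_psupp sg sa'; rewrite addNr in s1.
apply: (psupp_ext s1 (pone_psupp N0)) => k.
rewrite -{1}(addNr m') pconv_coef// pone_pexp// -(inv_coefsP k F0).
by apply: eq_bigr => i _; rewrite gE.
Qed.

Definition pinv (a : puiseux K) : puiseux K :=
  if pselect (exists b : puiseux K, b * a = 1) is left e then projT1 (cid e) else 0.

Lemma pmulVx (a : puiseux K) : a != 0 -> pinv a * a = 1.
Proof.
rewrite /pinv => /pinv_exists; case: pselect => // e _.
by case: (cid e).
Qed.

Lemma pinv0 : pinv 0 = 0.
Proof.
rewrite /pinv; case: pselect => // e; exfalso; case: e => b.
by rewrite mulr0 => /esym/eqP; rewrite oner_eq0.
Qed.

HB.instance Definition _ := GRing.ComNzRing_isField.Build (puiseux K) pmulVx pinv0.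

Lemma pcoefD (a b : puiseux K) q : (a + b) q = a q + b q. Proof. by []. Qed.

Lemma pcoefM (a b : puiseux K) q :
  (a * b) q = \sum_(r \in [set: rat]) a r * b (q - r).
Proof. by []. Qed.

Lemma pcoef1 q : (1 : puiseux K) q = (q == 0)%:R. Proof. by []. Qed.

(* Junk value 0 at the zero series. *)
Definition pval (a : puiseux K) : rat :=
  xget 0 [set q | a q != 0 /\ forall r, a r != 0 -> q <= r].

Lemma pvalP (a : puiseux K) : a != 0 ->
  a (pval a) != 0 /\ forall r, a r != 0 -> pval a <= r.
Proof.
move=> a0; have [N [m [N0 sa]]] := puiseux_psupp (series_puiseux a).
have exk : exists k, a (pexp N m k) != 0.
  apply: contrapT => /forallNP ak; move/eqP: a0; apply; apply: puiseuxP => q /=.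
  by apply/eqP/negPn/negP => aq; have [k qk] := sa _ aq; apply: (ak k); rewrite -qk.
case: (ex_minnP exk) => k0 ak0 mink0.
rewrite /pval; case: xgetP => [q _ //|/(_ (pexp N m k0))[]]; split=> // r ar.
have [k rk] := sa _ ar; rewrite rk /pexp ler_pM2r; last by rewrite invr_gt0 ltr0n.
by rewrite ler_int lerB// lez_nat mink0// -rk.
Qed.

End PuiseuxField.

Section MapPuiseux.
Variables (K L : fieldType) (phi : {rmorphism K -> L}).

Fact map_puiseux_subproof (a : puiseux K) : `[< is_puiseux (fun q => phi (a q)) >].
Proof.
have /asboolP[N [m [N0 sa]]] := pcoefP a.
by apply/asboolP; exists N, m; split=> // q; rewrite fmorph_eq0 => /sa.
Qed.

Definition map_puiseux (a : puiseux K) : puiseux L := Puiseux (map_puiseux_subproof a).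

Fact map_puiseux_is_zmod_morphism : zmod_morphism map_puiseux.
Proof. by move=> a b; apply: puiseuxP => q /=; rewrite rmorphB. Qed.

Fact map_puiseux_is_monoid_morphism : monoid_morphism map_puiseux.
Proof.
split=> [|a b]; apply: puiseuxP => q /=; first by rewrite /pone rmorph_nat.
rewrite /pconv rmorph_sum; set s := finite_support _ _ _.
rewrite (_ : s = finite_support 0 [set: rat] (fun r => phi (a r) * phi (b (q - r)))).
  by apply: eq_bigr => r _; rewrite rmorphM.
rewrite /s /finite_support !unlock; congr (finmap.enum_fset (fset_set _)).
apply/seteqP; split=> r [_ /eqP abr]; split=> //; apply/eqP.
  by rewrite -rmorphM fmorph_eq0.
by move: abr; rewrite -rmorphM fmorph_eq0.
Qed.

HB.instance Definition _ :=
  GRing.isZmodMorphism.Build _ _ map_puiseux map_puiseux_is_zmod_morphism.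
HB.instance Definition _ :=
  GRing.isMonoidMorphism.Build _ _ map_puiseux map_puiseux_is_monoid_morphism.

End MapPuiseux.

Section Tropicalization.
Variable R : realType.
Local Notation C := (puiseux R[i]).

Definition complex_puiseux : set C := setT.
Definition real_puiseux : set C := range (map_puiseux (real_complex R)).

Definition torus_points (K : set C) (N : nat) : set 'rV[C]_N :=
  [set x | forall i, K (x 0 i) /\ x 0 i != 0].

Arguments torus_points K N : clear implicits.

Definition pval_row (N : nat) (x : 'rV[C]_N) : 'rV[R]_N :=
  \row_i ratr (pval (x 0 i)).

Definition trop (K : set C) (N : nat) (X : set 'rV[C]_N) : set 'rV[R]_N :=
  closure (@pval_row N @` (X `&` torus_points K N)).

End Tropicalization.

Arguments complex_puiseux : clear implicits.
Arguments real_puiseux : clear implicits.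

Definition upper (n : nat) : pred ('I_n * 'I_n) := fun p => (p.1 <= p.2)%N.

Arguments upper : clear implicits.

Lemma card_upper (n : nat) : #|upper n| = 'C(n.+1, 2).
Proof.
rewrite -bin2_sum -sum1_card big_nat_recl// add0n big_mkord.
rewrite (eq_bigl (fun p : 'I_n * 'I_n => true && (p.1 <= p.2)%N))//.
rewrite -(pair_big_dep xpredT (fun i j : 'I_n => (i <= j)%N) (fun _ _ => 1%N))/=.
rewrite (exchange_big_dep xpredT)//=; apply: eq_bigr => j _.
rewrite (eq_bigl (fun i : 'I_n => (i < j.+1)%N))//.
by rewrite (big_ord_narrow (ltn_ord j)) sum_nat_const card_ord muln1.
Qed.

Definition sym_coords (A : Type) (n : nat) (M : 'M[A]_n) : 'rV[A]_#|upper n| :=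
  \row_k M (enum_val k).1 (enum_val k).2.

Definition singular_sym (R : realType) (n : nat) :
    set 'rV[puiseux R[i]]_#|upper n| :=
  [set sym_coords M | M in [set M : 'M[puiseux R[i]]_n | M^T = M /\ \det M = 0]].

Arguments singular_sym : clear implicits.

(* Main.v *)
(** Let [M] be a complex symmetric singular matrix with nonzero entries of
    valuations [w]. Two permutations use the same multiset of unordered edges
    [{k, s k}] only if they have the same sign, so no monomial of the symmetric
    determinant cancels, and [\det M = 0] forces two different monomials to
    attain the minimal weight for [w].

    Conversely let [X] have the entries [+/- lambda ^ theta_kl * t ^ w_kl], with
    [lambda] and the [theta_kl] chosen so that partial sums of the determinant do
    not cancel at leading order. Pick an edge [{i, j}] that the two minimal
    monomials use a different number of times, and multiply that entry of [X] by
    an unknown [y]. The determinant becomes a polynomial in [y] of degree at most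
    2 with at least two coefficients of minimal valuation, so it has a root of
    valuation [0] as soon as it splits, and this root produces a real singular
    matrix with valuations exactly [w]. If [i = j] the equation is linear. If
    [i != j] its discriminant is, up to squares, the product of the principal
    minors deleting [i] and [j] (Jacobi). Its leading coefficient is made positive
    by flipping the sign of one entry that the product of the two leading
    monomials uses an odd number of times; if there is no such entry, the two
    monomials have the same sign already. *)

From mathcomp Require Import all_fingroup ring lra zify.
Require Import Defs.
From mathcomp Require Import all_boot all_order all_algebra.
From mathcomp Require Import complex.
From mathcomp Require Import boolp classical_sets reals topology normedtype.
From mathcomp Require Import fsbigop.

Set Implicit Arguments.
Unset Strict Implicit.
Unset Printing Implicit Defensive.
Import Order.TTheory GRing.Theory Num.Theory.
Local Open Scope ring_scope.

(** * Leading terms of Puiseux series *)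

Section Lead.
Variable K : fieldType.
Implicit Types (a b : puiseux K) (c d : K) (q r : rat).

(* [c] may be [0]: then the valuation of [a] is [> q]. *)
Definition lead_at a q c := (forall r, r < q -> a r = 0) /\ a q = c.

Lemma lead_at0 q : lead_at 0 q 0. Proof. by []. Qed.

Lemma lead_at1 : lead_at 1 0 1.
Proof.
by split=> [r r0|]; rewrite pcoef1 ?eqxx//; rewrite lt_eqF.
Qed.

Lemma lead_atD a b q c d :
  lead_at a q c -> lead_at b q d -> lead_at (a + b) q (c + d).
Proof.
by move=> [a0 <-] [b0 <-]; split=> [r rq|//]; rewrite pcoefD a0// b0// addr0.
Qed.

Lemma lead_atN a q c : lead_at a q c -> lead_at (- a) q (- c).
Proof. by move=> [a0 <-]; split=> [r rq|//]; rewrite /= a0// oppr0. Qed.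

Lemma lead_atM a b q r c d :
  lead_at a q c -> lead_at b r d -> lead_at (a * b) (q + r) (c * d).
Proof.
move=> [a0 aq] [b0 br]; split=> [s sqr|]; rewrite pcoefM.
  apply: fsbig1 => u _; have [uq|qu] := ltP u q; first by rewrite a0 ?mul0r.
  by rewrite b0 ?mulr0//; lra.
rewrite (fsbigE [:: q])//.
  by rewrite big_cons big_nil mem_set// aq addrC addrA addNr add0r br [LHS]addr0.
move=> u _; rewrite inE neq_lt => /orP uq.
by case: uq => uq; [rewrite a0 ?mul0r|rewrite b0 ?mulr0//; lra].
Qed.

Lemma lead_at_lt a q r c : lead_at a q c -> r < q -> lead_at a r 0.
Proof. by move=> [a0 _] rq; split=> [s sr|]; rewrite a0// (lt_trans sr). Qed.

Lemma lead_at_inj a q c d : lead_at a q c -> lead_at a q d -> c = d.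
Proof. by move=> [_ <-] [_ <-]. Qed.

Lemma lead_at_sum (I : Type) (s : seq I) (P : pred I) (F : I -> puiseux K) q
    (c : I -> K) : (forall i, P i -> lead_at (F i) q (c i)) ->
  lead_at (\sum_(i <- s | P i) F i) q (\sum_(i <- s | P i) c i).
Proof.
move=> Fc; elim/big_ind2 : _ => [|a b c' d'|i /Fc//]; first exact: lead_at0.
by move=> ? ?; exact: lead_atD.
Qed.

Lemma lead_at_prod (I : Type) (s : seq I) (F : I -> puiseux K) (q : I -> rat)
    (c : I -> K) : (forall i, lead_at (F i) (q i) (c i)) ->
  lead_at (\prod_(i <- s) F i) (\sum_(i <- s) q i) (\prod_(i <- s) c i).
Proof.
move=> Fc; elim: s => [|i s IH]; first by rewrite !big_nil; exact: lead_at1.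
by rewrite !big_cons; exact: lead_atM.
Qed.

Lemma lead_at_pval a : a != 0 -> lead_at a (pval a) (a (pval a)).
Proof.
move=> /pvalP[_ mina]; split=> // r ra.
by apply/eqP/negPn/negP => /mina; rewrite leNgt ra.
Qed.

Lemma lead_at_neq0 a q c : lead_at a q c -> c != 0 -> a != 0.
Proof. by move=> [_ aq]; apply: contra_neq => a0; rewrite -aq a0. Qed.

Lemma lead_at_val a q c : lead_at a q c -> c != 0 -> pval a = q.
Proof.
move=> la c0; have [ap mina] := pvalP (lead_at_neq0 la c0).
case: la => a0 aq; apply/eqP; rewrite eq_le mina ?aq//= leNgt.
by apply/negP => /a0 /eqP; rewrite (negPf ap).
Qed.

Lemma lead_atV a q c : lead_at a q c -> c != 0 -> lead_at a^-1 (- q) c^-1.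
Proof.
move=> la c0; have a0 := lead_at_neq0 la c0.
have la' := lead_at_pval (invr_neq0 a0).
have [] := pvalP (invr_neq0 a0); set v := pval _ => va _.
have := lead_atM la la'; rewrite divff// => l1.
have := lead_at_val l1 (mulf_neq0 c0 va).
rewrite (lead_at_val lead_at1 (oner_neq0 _)) => /eqP; rewrite eq_sym addr_eq0 => /eqP qv.
have vq : v = - q by rewrite qv opprK.
move: la'; rewrite -/v vq; suff -> : a^-1 (- q) = c^-1 by [].
move: l1; rewrite -/v qv addNr -qv => /(lead_at_inj lead_at1) /esym; rewrite vq => ce.
by apply: (mulfI c0); rewrite ce divff.
Qed.

Fact mono_puiseux c q : is_puiseux (fun r => if r == q then c else 0).
Proof.
exists `|denq q|%N, (numq q); rewrite absz_gt0 denq_neq0; split=> // r.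
have [-> _|] := eqVneq r q; last by rewrite eqxx.
by exists (numq q); split; rewrite // pmulrn absz_denq divq_num_den.
Qed.

Definition mono c q : puiseux K := mkPuiseux (mono_puiseux c q).

Lemma lead_at_mono c q : lead_at (mono c q) q c.
Proof. by split=> [r rq|]; rewrite /= ?eqxx// lt_eqF. Qed.

End Lead.

Lemma lead_at_nat (K : fieldType) m : lead_at (m%:R : puiseux K) 0 m%:R.
Proof.
by elim: m => [|m IH]; [exact: lead_at0|rewrite -!natr1; exact: lead_atD (lead_at1 K)].
Qed.

Lemma lead_at_map (K L : fieldType) (f : {rmorphism K -> L}) (a : puiseux K) q c :
  lead_at a q c -> lead_at (map_puiseux f a) q (f c).
Proof. by move=> [a0 <-]; split=> [r rq|//]; rewrite /= a0// rmorph0. Qed.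

(** * Square roots of Puiseux series *)

Section Sqrt.
Variable K : fieldType.
Hypothesis two_neq0 : 2%:R != 0 :> K.

(** Comparing coefficients of degree [k'] in [G ^ 2 = F] isolates [2 r G_k']: only the two extreme
    products contain the unknown, the inner ones are already known. *)
Fixpoint sqrt_coefs (F : nat -> K) (r : K) (k : nat) : seq K :=
  if k is k'.+1 then
    let s := sqrt_coefs F r k' in
    rcons s (if k' is k''.+1 then
      (F k' - \sum_(i < k'') s`_i.+1 * s`_(k'' - i)) / (2%:R * r) else r)
  else [::].

Lemma size_sqrt_coefs F r k : size (sqrt_coefs F r k) = k.
Proof. by elim: k => //= k IH; rewrite size_rcons IH. Qed.

Lemma nth_sqrt_coefs F r k i : (i < k)%N ->
  (sqrt_coefs F r k)`_i = (sqrt_coefs F r i.+1)`_i.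
Proof.
elim: k => // k IH; rewrite ltnS leq_eqVlt => /predU1P[->//|ik].
by rewrite [LHS]/= nth_rcons size_sqrt_coefs ik IH.
Qed.

Lemma sqrt_power_series (F : nat -> K) (r : K) : r != 0 -> F 0%N = r ^+ 2 ->
  exists G : nat -> K, forall k, \sum_(i < k.+1) G i * G (k - i)%N = F k.
Proof.
move=> r0 F0; pose G k := (sqrt_coefs F r k.+1)`_k; exists G.
have G0 : G 0%N = r by [].
case=> [|k]; first by rewrite big_ord_recl big_ord0 addr0 subn0 G0 F0 expr2.
have GS : G k.+1 = (F k.+1 - \sum_(i < k) G i.+1 * G (k - i)%N) / (2%:R * r).
  rewrite {1}/G [sqrt_coefs _ _ _]/= -/(sqrt_coefs F r k.+1).
  rewrite nth_rcons size_sqrt_coefs ltnn eqxx.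
  congr ((_ - _) / _); apply: eq_bigr => i _.
  rewrite !nth_sqrt_coefs//; [lia|by case: i => i /=; lia].
rewrite big_ord_recl big_ord_recr /= subn0 subnn G0.
rewrite (eq_bigr (fun i : 'I_k => G i.+1 * G (k - i)%N)); last by [].
rewrite GS; field.
by rewrite r0 two_neq0.
Qed.

(** Dividing by [t ^ q] leaves a power series in some [t ^ (1 / N)] with constant term [c ^ 2],
    whose root is found coefficientwise; [t ^ q] itself is a square because exponents are
    rational. *)
Lemma puiseux_sqrt (a : puiseux K) q c :
  c != 0 -> lead_at a q (c ^+ 2) -> exists d, d ^+ 2 = a.
Proof.
move=> c0 la; pose b := mono 1 (- q) * a.
have lb : lead_at b 0 (c ^+ 2).
  by have := lead_atM (lead_at_mono 1 (- q)) la; rewrite mul1r addNr.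
have ab : a = mono 1 (q / 2%:R) ^+ 2 * b.
  rewrite /b mulrA -{1}[a]mul1r; congr (_ * a); apply: puiseuxP => r.
  rewrite expr2.
  have mM c1 q1 c2 q2 : mono c1 q1 * mono c2 q2 = mono (c1 * c2) (q1 + q2) :> puiseux K.
    apply: puiseuxP => s; rewrite pcoefM (fsbigE [:: q1])//=.
      rewrite big_cons big_nil mem_set// eqxx [LHS]addr0.
      by rewrite subr_eq addrC; case: eqP; rewrite ?mulr0.
    move=> u _ /=; rewrite inE => /negPf uq.
    by rewrite uq mul0r.
  rewrite !mM !mulr1 pcoef1 /= (_ : _ + _ = 0); last by field.
  by case: eqP.
have [N [m [N0 sb]]] := puiseux_psupp (series_puiseux b).
(* The support given by [puiseux_psupp] may start at [- m / N]; since [b] has no negative exponents,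
   it can be taken to start at 0. *)
have sb0 : psupp N 0 b.
  move=> s bs; have [k sk] := sb _ bs; exists (k - m)%N.
  have s0 : 0 <= s by rewrite leNgt; apply/negP => /lb.1 /eqP; rewrite (negPf bs).
  rewrite sk /pexp; congr (_%:~R / _).
  have : (m <= k)%N.
    move: s0; rewrite sk /pexp pmulr_lge0 ?invr_gt0 ?ltr0n// ler0z subr_ge0; lia.
  lia.
have p00 : pexp N 0 0 = 0 by rewrite /pexp subrr mul0r.
have [|G GP] := @sqrt_power_series (fun k => b (pexp N 0 k)) c c0.
  by rewrite p00 lb.2.
pose g s := if pselect (exists k, s = pexp N 0 k) is left e
            then G (projT1 (cid e)) else 0.
have gE k : g (pexp N 0 k) = G k.
  rewrite /g; case: pselect => [e|[]]; last by exists k.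
  by case: (cid e) => j /= /(pexp_inj N0) ->.
have sg : psupp N 0 g by move=> s; rewrite /g; case: pselect; rewrite ?eqxx.
pose h := mkPuiseux (psupp_puiseux N0 sg).
exists (mono 1 (q / 2%:R) * h); rewrite exprMn ab; congr (_ * _).
rewrite expr2; apply: val_inj => /=.
have s1 := pconv_psupp sg sg; rewrite addr0 in s1.
apply: (psupp_ext s1 sb0) => k.
rewrite -{1}(addr0 0) pconv_coef// -GP.
by apply: eq_bigr => i _; rewrite !gE.
Qed.

End Sqrt.

(** * Signs of permutations and edge counts *)

Section PermParity.
Variable T : finType.
Implicit Types s t : {perm T}.

(** The points of an orbit share its contribution 1 equally, so that orbits can be counted point by
    point. *)
Lemma card_porbits_sum s :
  #|porbits s|%:R = \sum_x (#|porbit s x|%:R)^-1 :> rat.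
Proof.
rewrite (partition_big (porbit s) (mem (porbits s)))/=; last first.
  by move=> x _; exact: imset_f.
rewrite -sum1_card natr_sum; apply: eq_bigr => _ /imsetP[x _ ->].
rewrite (eq_bigr (fun=> (#|porbit s x|%:R)^-1 : rat)); last by move=> y /eqP ->.
rewrite (eq_bigl (mem (porbit s x))); last by move=> y; rewrite eq_porbit_mem.
rewrite sumr_const -[RHS]mulr_natr mulVf//.
by rewrite pnatr_eq0 card_porbit_neq0.
Qed.

Lemma porbit_fix2 s x : s (s x) = x ->
  #|porbit s x| = if s x == x then 1%N else 2%N.
Proof.
move=> ssx; have -> : porbit s x = [set x; s x].
  apply/setP => y; rewrite !inE; apply/idP/idP; last first.
    by case/orP => /eqP ->; [exact: porbit_id|exact: (mem_porbit s 1)].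
  case/porbitP => i ->; rewrite permX; elim: i => [|i IH]; first by rewrite eqxx.
  by rewrite iterS; case/orP: IH => /eqP ->; rewrite ?ssx eqxx ?orbT.
by rewrite cards2 eq_sym; case: eqP.
Qed.

(** The points on cycles of length at least 3. *)
Definition long s x := s (s x) != x.

Lemma long_perm s x : long s (s x) = long s x.
Proof. by rewrite /long (inj_eq perm_inj). Qed.

(** On long cycles of [s], a step of [t] goes forward or backward along [s], so a [t]-orbit starting
    there never leaves its cycle. *)
Lemma sub_porbit s t x : long s x ->
    (forall y, long s y -> t y = s y \/ s (t y) = y) ->
  {subset porbit t x <= porbit s x}.
Proof.
move=> lx st y /porbitP[i ->]; rewrite permX.
have : iter i t x \in porbit s x /\ long s (iter i t x).
  elim: i => [|i [IH li]]; first by rewrite porbit_id.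
  rewrite iterS; set z := iter _ _ _ in IH li *.
  have [->|stz] := st _ li.
    by rewrite long_perm li -eq_porbit_mem (porbit_perm s 1) eq_porbit_mem.
  split; last by rewrite -long_perm stz.
  by rewrite -eq_porbit_mem -(porbit_perm s 1) expg1 stz eq_porbit_mem.
by case.
Qed.

(* A cycle of length at least 3 is read off the edges used exactly once, and
   cycles of length 1 or 2 are counted by their fixed points. *)
Lemma odd_perm_eq s t :
    (forall x y, x != y ->
      (s x == y) (+) (s y == x) = (t x == y) (+) (t y == x)) ->
    (#|[pred x | s x == x]| = #|[pred x | t x == x]|) ->
  odd_perm s = odd_perm t.
Proof.
move=> st fst; rewrite /odd_perm; congr (_ (+) odd _).
(* The edge [{x, u x}] is used once by [u], so [v] traverses it in exactly one direction; this also
   keeps [x] off the 1- and 2-cycles of [v]. *)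
have sub (u v : {perm T}) : (forall x y, x != y ->
      (u x == y) (+) (u y == x) = (v x == y) (+) (v y == x)) ->
    forall x, long u x -> long v x /\ (u x = v x \/ v (u x) = x).
  move=> uv x lx; have uxx : x != u x.
    by apply: contraNneq lx => e; rewrite -!e eqxx.
  have := uv _ _ uxx; rewrite eqxx (negPf lx)/=.
  have [vx|vx] := eqVneq (v x) (u x).
    rewrite /long vx /=; case: eqP => //= _ _; split; [by []|by left].
  rewrite /=; case: eqP => //= vux _; split; last by right.
  by apply: contraNneq vx => e; apply/eqP/(@perm_inj _ v); rewrite vux.
have lst x : long s x = long t x.
  by apply/idP/idP => /sub => [/(_ _ st)|/(_ _ (fun x y xy => esym (st x y xy)))] [].
have pst x : long s x -> porbit s x = porbit t x.
  move=> lx; apply/setP => y; apply/idP/idP; apply: sub_porbit => //.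
  - by rewrite -lst.
  - by move=> z; rewrite -lst => /(sub _ _ st)[].
  - move=> z; rewrite lst => /sub-/(_ _ (fun x y xy => esym (st x y xy)))[] _.
    by [].
(* A fixed point has share 1 and a point of a 2-cycle share 1/2, so off the long cycles only the
   number of fixed points matters. *)
have cardE (u : {perm T}) x : ~~ long u x ->
    (#|porbit u x|%:R)^-1 = 2%:R^-1 + (u x == x)%:R / 2%:R :> rat.
  by rewrite negbK => /eqP /porbit_fix2 ->; case: eqP => _ /=; field.
have fixl (u : {perm T}) x : u x == x -> ~~ long u x by rewrite /long => /eqP ux; rewrite !ux eqxx.
have fixE (u : {perm T}) : \sum_(x | ~~ long u x) (u x == x)%:R / 2%:R =
    #|[pred x | u x == x]|%:R / 2%:R :> rat.
  rewrite -sum1_card natr_sum mulr_suml big_mkcond [RHS]big_mkcond/=.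
  apply: eq_bigr => x _; rewrite inE; case: (boolP (u x == x)) => ux.
    by rewrite fixl.
  by rewrite mul0r if_same.
apply/eqP; rewrite -(eqr_nat rat) !card_porbits_sum.
rewrite (bigID (long s)) [X in _ == X](bigID (long t))/= -(eq_bigl _ _ lst).
have -> : \sum_(x | long s x) (#|porbit s x|%:R)^-1 =
    \sum_(x | long s x) (#|porbit t x|%:R)^-1 :> rat.
  by apply: eq_bigr => x lx; rewrite pst.
rewrite (eq_bigr _ (cardE s)) [X in _ == _ + X](eq_bigr _ (cardE t)).
rewrite !big_split/= !fixE fst; apply/eqP; congr (_ + (_ + _)).
by apply: eq_bigl => x; rewrite lst.
Qed.

End PermParity.

Section EdgeCount.
Variable n : nat.
Implicit Types (s t : 'S_n) (i j k l : 'I_n).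

(** Unordered pairs are encoded as two-digit numerals in base [n], so a number that is at least
    [n * n] is no edge. *)
Definition edge k l : nat := (minn k l * n + maxn k l)%N.

Lemma edgeC k l : edge k l = edge l k.
Proof. by rewrite /edge minnC maxnC. Qed.

Lemma edge_lt k l : (edge k l < n * n)%N.
Proof. by rewrite /edge; have := ltn_ord k; have := ltn_ord l; nia. Qed.

Lemma edge_inj i j k l : edge i j = edge k l -> (i = k /\ j = l) \/ (i = l /\ j = k).
Proof.
move=> e; have mM : (maxn i j < n)%N /\ (maxn k l < n)%N.
  by rewrite !gtn_max !ltn_ord.
have e1 : maxn i j = maxn k l.
  have := congr1 (modn^~ n) e.
  by rewrite /edge !modnMDl !modn_small; [|case: mM..].
have e2 : minn i j = minn k l.
  have n0 : (0 < n)%N by case: mM; lia.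
  have := congr1 (divn^~ n) e.
  by rewrite /edge !divnMDl// !divn_small ?addn0; [|case: mM..].
have : (i = k :> nat /\ j = l :> nat) \/ (i = l :> nat /\ j = k :> nat) by lia.
by case=> -[/ord_inj ? /ord_inj ?]; [left|right].
Qed.

Lemma edge_eq i j k l : (edge i j == edge k l) =
  ((i == k) && (j == l)) || ((i == l) && (j == k)).
Proof.
apply/eqP/idP => [/edge_inj[[-> ->]|[-> ->]]|]; rewrite ?eqxx ?orbT//.
by case/orP => /andP[/eqP -> /eqP ->] //; rewrite edgeC.
Qed.

Definition ecount s (c : nat) : nat := \sum_k (edge k (s k) == c).

Lemma ecount_off s i j : i != j ->
  ecount s (edge i j) = ((s i == j) + (s j == i))%N.
Proof.
move=> ij; rewrite /ecount (bigD1 i)//= (bigD1 j)/=; last by rewrite eq_sym.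
rewrite big1 => [|k /andP[/negPf ki /negPf kj]]; last by rewrite edge_eq ki kj.
by rewrite !edge_eq !eqxx (negPf ij) (eq_sym j) (negPf ij) orbF addn0.
Qed.

Lemma ecount_diag s i : ecount s (edge i i) = (s i == i).
Proof.
rewrite /ecount (bigD1 i)//= big1 ?addn0; last first.
  by move=> k /negPf ki; rewrite edge_eq ki.
by rewrite edge_eq eqxx orbb.
Qed.

Lemma ecount_le s c : (ecount s c <= n)%N.
Proof.
rewrite -[leqRHS]card_ord -sum1_card; apply: leq_sum => k _.
exact: leq_b1.
Qed.

Lemma ecount_big s c : (n * n <= c)%N -> ecount s c = 0%N.
Proof.
move=> nc; rewrite /ecount big1// => k _; have := edge_lt k (s k).
by case: eqP => //; lia.
Qed.

Lemma prod_edge (A : comPzSemiRingType) (u : nat -> A) s :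
  \prod_k u (edge k (s k)) = \prod_(c < n * n) u c ^+ ecount s c.
Proof.
rewrite (partition_big (fun k => Ordinal (edge_lt k (s k))) xpredT)//=.
apply: eq_bigr => c _; rewrite /ecount (eq_bigr (fun=> u c)); last first.
  by move=> k /eqP <-.
rewrite prodr_const; congr (_ ^+ _); rewrite -sum1_card big_mkcond.
apply: eq_bigr => k _.
by rewrite unfold_in -[eqn _ _]/(edge k (s k) == c); case: eqP.
Qed.

(** A symmetric [u] factors through [edge], and a product over edges depends only on the edge
    counts. *)
Lemma prod_sym (A : comPzSemiRingType) (u : 'I_n -> 'I_n -> A) s t :
  (forall k l, u k l = u l k) -> ecount s =1 ecount t ->
  \prod_k u k (s k) = \prod_k u k (t k).
Proof.
move=> uC st; pose v c := if [pick p | edge p.1 p.2 == c] is Some p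
                          then u p.1 p.2 else 1.
have uv k l : u k l = v (edge k l).
  rewrite /v; case: pickP => [[i j]|/(_ (k, l))/=]; last by rewrite eqxx.
  by rewrite edge_eq => /orP[] /andP[/eqP -> /eqP ->].
rewrite !(eq_bigr _ (fun k _ => uv k _)) !prod_edge.
by apply: eq_bigr => c _; rewrite st.
Qed.

Lemma digits_inj (b L : nat) (p q : nat -> nat) :
  (forall c, p c < b)%N -> (forall c, q c < b)%N ->
  (\sum_(c < L) p c * b ^ c = \sum_(c < L) q c * b ^ c)%N ->
  forall c, (c < L)%N -> p c = q c.
Proof.
elim: L p q => [//|L IH] p q pb qb.
have shift (r : nat -> nat) : (\sum_(c < L.+1) r c * b ^ c =
    (\sum_(c < L) r c.+1 * b ^ c) * b + r 0)%N.
  rewrite big_ord_recl /= expn0 muln1 addnC big_distrl/=; congr (_ + _)%N.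
  by apply: eq_bigr => c _; rewrite /bump /= add1n expnSr mulnA.
rewrite !shift => e; have p0 : p 0%N = q 0%N.
  by have := congr1 (modn^~ b) e; rewrite /= !modnMDl !modn_small.
have IH' := IH _ _ (fun c => pb c.+1) (fun c => qb c.+1) _.
case=> [//|c]; rewrite ltnS; apply: IH'.
by apply/eqP; rewrite -(eqn_pmul2r (leq_ltn_trans (leq0n _) (pb 0%N))); apply/eqP; lia.
Qed.

(** The edge counts are at most [n], hence they are the digits of [theta s] in base [n.+1] and can
    be recovered from it. *)
Definition theta s : nat := \sum_k n.+1 ^ edge k (s k).

Lemma theta_inj s t : theta s = theta t -> ecount s =1 ecount t.
Proof.
have thetaE r : theta r = (\sum_(c < n * n) ecount r c * n.+1 ^ c)%N.
  rewrite /theta (partition_big (fun k => Ordinal (edge_lt k (r k))) xpredT)//=.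
  apply: eq_bigr => c _; rewrite /ecount big_distrl/= big_mkcond.
  apply: eq_bigr => k _; rewrite -[edge k (r k) == c]/(Ordinal (edge_lt k (r k)) == c).
  by case: eqP => [<-|_]; rewrite ?mul1n ?mul0n.
rewrite !thetaE => e c; have [cn|nc] := ltnP c (n * n); last by rewrite !ecount_big.
by apply: (digits_inj _ _ e) => // d; rewrite ltnS ecount_le.
Qed.

Lemma odd_perm_ecount s t :
    (forall i j, i != j -> odd (ecount s (edge i j)) = odd (ecount t (edge i j))) ->
    (\sum_i ecount s (edge i i) = \sum_i ecount t (edge i i))%N ->
  odd_perm s = odd_perm t.
Proof.
move=> st; rewrite !(eq_bigr _ (fun i _ => ecount_diag _ i)) => fst.
apply: odd_perm_eq => [i j /[dup] ij /st|].
  by rewrite !ecount_off// !oddD !oddb.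
move: fst; rewrite -!sum1_card => e.
by do 2![rewrite [RHS]big_mkcond [LHS]big_mkcond /=]; rewrite /in_mem/=.
Qed.

End EdgeCount.

(** * Sums dominated by their highest power *)

Section Dominance.
Variables (R : realFieldType) (I : finType).

(** Terms with exponent [th i0] share the sign of [e i0] and add up. With [lam = #|I|.+1], each
    other term is at most [lam ^+ th i0 / lam] in absolute value, and there are fewer than [lam] of
    them. *)
Lemma dominant_sum (P : pred I) (e : I -> R) (th : I -> nat) (i0 : I) :
  P i0 -> (forall i, `|e i| = 1) ->
  (forall i, P i -> (th i <= th i0)%N) ->
  (forall i, P i -> th i = th i0 -> e i = e i0) ->
  0 < e i0 * \sum_(i | P i) e i * #|I|.+1%:R ^+ th i.
Proof.
move=> P0 e1 thle the; set lam : R := _%:R; pose mu := lam ^+ th i0 / lam.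
have lam0 : 0 < lam by rewrite ltr0n.
have mu0 : 0 < mu by rewrite divr_gt0// exprn_gt0.
have lamE : lam ^+ th i0 = mu * lam by rewrite /mu divfK ?gt_eqF.
have ee : e i0 * e i0 = 1.
  by have := congr1 (fun x => x ^+ 2) (e1 i0); rewrite /= real_normK ?num_real// expr1n expr2.
rewrite mulr_sumr (bigD1 i0)//= mulrA ee mul1r.
have : \sum_(i | P i && (i != i0)) - mu <=
    \sum_(i | P i && (i != i0)) e i0 * (e i * lam ^+ th i).
  apply: ler_sum => i /andP[Pi _]; rewrite mulrA.
  have [E|ne] := eqVneq (th i) (th i0).
    by rewrite (the i)// ee mul1r E (le_trans (y := 0))// ?oppr_le0 ?exprn_ge0// ltW.
  have lt : (th i < th i0)%N by rewrite ltn_neqAle ne thle.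
  have le : lam ^+ th i <= mu.
    rewrite /mu ler_pdivlMr// -exprSr ler_weXn2l// /lam.
    by rewrite ler1n.
  have := ler_norm (- (e i0 * e i * lam ^+ th i)).
  rewrite normrN !normrM !e1 !mul1r normrX (gtr0_norm lam0); lra.
rewrite sumr_const -mulr_natr => le; rewrite lamE.
set m := #|_| in le; have : m%:R <= #|I|%:R :> R by rewrite ler_nat max_card.
have lamS : lam = #|I|%:R + 1 by rewrite /lam -natr1.
move: le; set S := \sum_(i | _) _ => le; rewrite lamS => mI; have mumI := ler_wpM2l (ltW mu0) mI.
by rewrite mulNr in le; rewrite mulrDr mulr1; lra.
Qed.

End Dominance.

(** * Determinants with one rescaled entry *)

Section DetSum.
Variables (K : comNzRingType) (n : nat).
Implicit Types (X : 'M[K]_n) (S : pred 'S_n) (i j : 'I_n).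

Definition psum S X := \sum_(s | S s) (-1) ^+ s * \prod_k X k (s k).

Lemma det_hadamard X (h : 'I_n -> 'I_n -> K) :
  \det (\matrix_(k, l) (X k l * h k l)) =
  \sum_(s : 'S_n) (-1) ^+ s * \prod_k X k (s k) * \prod_k h k (s k).
Proof.
rewrite /determinant; apply: eq_bigr => s _; rewrite -mulrA -big_split.
by congr (_ * _); apply: eq_bigr => k _; rewrite mxE.
Qed.

(** One family for two purposes: [z = z' = 1] gives the quadratic in [y] to be solved, and zero
    factors isolate the sums over permutations fixing [i] or [j]. *)
Definition scale2 X i j (z z' y : K) := \matrix_(k, l) (X k l *
  (if (k == i) && (l == i) then z else if (k == j) && (l == j) then z'
   else if (k == i) && (l == j) || (k == j) && (l == i) then y else 1)).

Lemma det_scale2 X i j z z' y : i != j -> \det (scale2 X i j z z' y) =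
  \sum_(s : 'S_n) (-1) ^+ s * \prod_k X k (s k) *
    ((if s i == i then z else if s i == j then y else 1) *
     (if s j == j then z' else if s j == i then y else 1)).
Proof.
move=> ij; have ji : j == i = false by rewrite eq_sym (negPf ij).
rewrite det_hadamard; apply: eq_bigr => s _; congr (_ * _).
rewrite (bigD1 i)//= (bigD1 j) ?ji//= big1 => [|k /andP[/negPf ki /negPf kj]].
  by rewrite !eqxx ?ji ?(negPf ij) mulr1 /= ?orbF.
by rewrite ki kj.
Qed.

(** The next three classes use the edge [{i, j}] twice, once and never; their sums are the
    coefficients of the quadratic in [y]. *)
Definition pswap i j : pred 'S_n := [pred s : 'S_n | (s i == j) && (s j == i)].
Definition phalf i j : pred 'S_n := [pred s : 'S_n | (s i == j) (+) (s j == i)].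
Definition pnone i j : pred 'S_n := [pred s : 'S_n | (s i != j) && (s j != i)].
(** The sum over this class is [X i i] times the principal minor deleting [i]. *)
Definition pfix i : pred 'S_n := [pred s : 'S_n | s i == i].

Lemma det_scale_edge X i j y : i != j -> \det (scale2 X i j 1 1 y) =
  psum (pswap i j) X * y ^+ 2 + psum (phalf i j) X * y + psum (pnone i j) X.
Proof.
move=> ij; rewrite det_scale2// /psum !mulr_suml.
rewrite ![\sum_(s | pswap _ _ _) _]big_mkcond ![\sum_(s | phalf _ _ _) _]big_mkcond.
rewrite ![\sum_(s | pnone _ _ _) _]big_mkcond -!big_split; apply: eq_bigr => s _ /=.
rewrite /pswap /phalf /pnone /=; set u := _ * \prod_k _; have ji : j == i = false by rewrite eq_sym (negPf ij).
have [si|_] := eqVneq (s i) i; have [sj|_] := eqVneq (s j) j.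
- by rewrite si sj ji (negPf ij) /=; ring.
- by rewrite si (negPf ij) /=; case: (s j =P i) => [sj|_] /=; [
    move: ij; rewrite -(inj_eq (@perm_inj _ s)) si sj eqxx|ring].
- by rewrite sj ji /=; case: (s i == j) => /=; ring.
- by case: (s i == j); case: (s j == i) => /=; ring.
Qed.

Lemma det_scale_diag X i z : \det (\matrix_(k, l)
    (X k l * (if (k == i) && (l == i) then z else 1))) =
  psum (pfix i) X * z + psum (predC (pfix i)) X.
Proof.
have hE (s : 'S_n) : \prod_k (if (k == i) && (s k == i) then z else 1) =
    if s i == i then z else 1.
  by rewrite (bigD1 i)//= big1 ?eqxx ?mulr1 => [|k /negPf ->].
rewrite det_hadamard (bigID (pfix i)) /psum mulr_suml /=; congr (_ + _).
  by apply: eq_bigr => s si; rewrite hE ifT.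
by apply: eq_bigr => s /negPf si; rewrite hE ifF ?mulr1.
Qed.

(** A term with [s i = i] involves neither [(i, j)] nor [(j, i)], so [y = 0] leaves it intact; such
    terms are exactly those lost when the factor of [(i, i)] drops from 1 to 0. *)
Lemma psum_fixl X i j : i != j -> psum (pfix i) X =
  \det (scale2 X i j 1 1 0) - \det (scale2 X i j 0 1 0).
Proof.
move=> ij; rewrite !det_scale2// /psum big_mkcond -sumrB; apply: eq_bigr => s _; rewrite /pfix /=.
case: (s i =P i) => [si|_]; last by rewrite subrr.
rewrite mul0r mulr0 subr0 mul1r; case: (s j =P i) => [sj|_].
  by have := inj_eq (@perm_inj _ s) i j; rewrite si sj eqxx (negPf ij).
by rewrite if_same mulr1.
Qed.

Lemma scale2C X i j z z' y : i != j -> scale2 X i j z z' y = scale2 X j i z' z y.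
Proof.
move=> ij; apply/matrixP => k l; rewrite !mxE; congr (_ * _).
have [->|_] := eqVneq k i; last by rewrite /= orbF.
by rewrite (negPf ij) /= orbF; case: eqP.
Qed.

Lemma psum_fixr X i j : i != j -> psum (pfix j) X =
  \det (scale2 X i j 1 1 0) - \det (scale2 X i j 1 0 0).
Proof. by move=> ij; rewrite !(scale2C _ _ _ _ ij) -psum_fixl// eq_sym. Qed.

(** Its determinant is [- X i j * X j i] times the minor deleting [i] and [j], which expresses the
    invertibility of the complementary block without reordering indices. *)
Definition swap_mx X i j := \matrix_(k, l) (X k l *
  (if k == i then (l == j)%:R else if k == j then (l == i)%:R else 1)).

Lemma det_swap_mx X i j : i != j -> \det (swap_mx X i j) = psum (pswap i j) X.
Proof.
move=> ij; have ji : j == i = false by rewrite eq_sym (negPf ij).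
rewrite det_hadamard /psum [RHS]big_mkcond; apply: eq_bigr => s _; rewrite /pswap /=.
set u := (-1) ^+ s * \prod_k X k (s k).
rewrite (bigD1 i)//= (bigD1 j) ?ji//= big1 => [|k /andP[/negPf -> /negPf ->]//].
by rewrite !eqxx ?ji mulr1; case: (s i == j); case: (s j == i); rewrite /= ?(mulr0, mulr1).
Qed.

(** Simultaneous renumbering of rows and columns, used to bring [i] and [j] to the first two
    positions. *)
Definition conj_mx (p : 'S_n) X := \matrix_(k, l) X (p k) (p l).

Lemma det_conj_mx p X : \det (conj_mx p X) = \det X.
Proof.
have -> : conj_mx p X = row_perm p (col_perm p X).
  by apply/matrixP => k l; rewrite !mxE.
rewrite row_permE col_permE !det_mulmx !det_perm odd_permV mulrCA.
by rewrite -expr2 sqrr_sign mulr1.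
Qed.

Lemma conj_scale2 p X i j z z' y :
  conj_mx p (scale2 X (p i) (p j) z z' y) = scale2 (conj_mx p X) i j z z' y.
Proof. by apply/matrixP => k l; rewrite !mxE !(inj_eq perm_inj). Qed.

Lemma conj_swap p X i j :
  conj_mx p (swap_mx X (p i) (p j)) = swap_mx (conj_mx p X) i j.
Proof. by apply/matrixP => k l; rewrite !mxE !(inj_eq perm_inj). Qed.

End DetSum.

(** * Schur complements and Jacobi's identity *)

Section Schur.
Variable K : fieldType.

Lemma det_schur m1 m2 (A : 'M[K]_m1) (B : 'M[K]_(m1, m2)) C (D : 'M[K]_m2) :
  \det D != 0 -> \det (block_mx A B C D) = \det D * \det (A - B *m invmx D *m C).
Proof.
move=> D0; have uD : D \in unitmx by rewrite unitmxE unitfE.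
have -> : block_mx A B C D =
    block_mx (A - B *m invmx D *m C) B 0 D *m block_mx 1%:M 0 (invmx D *m C) 1%:M.
  rewrite mulmx_block !mulmx1 !mulmx0 !add0r mulKVmx//.
  by rewrite mulmxA subrK.
by rewrite det_mulmx det_ublock det_lblock !det1 !mulr1 mulrC.
Qed.

(** The scaling touches only the upper left 2 by 2 block, so the Schur complement of the block [D]
    always subtracts the same symmetric matrix [G]; [p], [q], [r] are its entries and [d] is
    [\det D]. *)
Lemma det_scale2_block m (X : 'M[K]_(2 + m)) (i := lshift m 0) (j := lshift m 1) :
  X^T = X -> \det (swap_mx X i j) != 0 ->
  exists d p q r, forall z z' y, \det (scale2 X i j z z' y) =
    d * ((X i i * z - p) * (X j j * z' - r) - (X i j * y - q) ^+ 2).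
Proof.
move=> sX; have ij : i != j by [].
set D := drsubmx X; rewrite -[swap_mx _ _ _]submxK.
have -> : ursubmx (swap_mx X i j) = 0.
  apply/matrixP => k l; rewrite !mxE -!val_eqE /=.
  by case: k => [[|[|//]] ?] /=; rewrite mulr0.
have -> : drsubmx (swap_mx X i j) = D.
  by apply/matrixP => k l; rewrite !mxE -!val_eqE /= mulr1.
rewrite det_lblock mulf_eq0 negb_or => /andP[_ D0].
set G := ursubmx X *m invmx D *m dlsubmx X.
have sG : G 1 0 = G 0 1.
  have : G^T = G.
    by rewrite /G !trmx_mul trmx_inv trmx_drsub trmx_ursub trmx_dlsub sX mulmxA.
  by move=> /matrixP/(_ 0 1); rewrite mxE.
exists (\det D), (G 0 0), (G 0 1), (G 1 1) => z z' y.
rewrite -[scale2 _ _ _ _ _ _]submxK.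
have -> : drsubmx (scale2 X i j z z' y) = D.
  by apply/matrixP => k l; rewrite !mxE -!val_eqE /= mulr1.
have -> : ursubmx (scale2 X i j z z' y) = ursubmx X.
  by apply/matrixP => k l; rewrite !mxE -!val_eqE /= !andbF mulr1.
have -> : dlsubmx (scale2 X i j z z' y) = dlsubmx X.
  by apply/matrixP => k l; rewrite !mxE -!val_eqE /= mulr1.
rewrite det_schur// -/G; congr (_ * _); move: G sG => G sG.
have Xji : X j i = X i j by rewrite -{1}sX mxE.
rewrite (expand_det_row _ 0) !big_ord_recl big_ord0 addr0 /cofactor !det_mx11.
rewrite !mxE -!val_eqE /= -/i -/j expr0 expr1 !mul1r.
rewrite [lshift m (lift _ _)](_ : _ = j); last exact/val_inj.
have -> : lift 0 0 = 1 :> 'I_2 by exact/val_inj.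
have -> : lift 1 0 = 0 :> 'I_2 by exact/val_inj.
by rewrite -/i Xji sG; ring.
Qed.

Lemma det_scale2E n (X : 'M[K]_n) i j : i != j ->
  X^T = X -> psum (pswap i j) X != 0 ->
  exists d p q r, forall z z' y, \det (scale2 X i j z z' y) =
    d * ((X i i * z - p) * (X j j * z' - r) - (X i j * y - q) ^+ 2).
Proof.
case: n X i j => [|[|m]] X i j ij; [by case: i ij|by rewrite !ord1 in ij|].
move=> sX; rewrite -det_swap_mx// => sw0.
pose i0 : 'I_(2 + m) := lshift m 0; pose j0 : 'I_(2 + m) := lshift m 1.
have [p [pi pj]] : exists p : 'S_(2 + m), p i0 = i /\ p j0 = j.
  have k0 : tperm i0 i j != i0.
    by rewrite -[X in _ != X](tpermR i0 i) (inj_eq perm_inj) eq_sym.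
  exists (tperm j0 (tperm i0 i j) * tperm i0 i)%g; rewrite !permM; split.
    by rewrite [tperm j0 _ i0]tpermD// tpermL.
  by rewrite tpermL tpermK.
have sY : (conj_mx p X)^T = conj_mx p X.
  by apply/matrixP => k l; rewrite !mxE -{1}sX mxE.
have [|d [a [b [c E]]]] := det_scale2_block sY.
  by rewrite -conj_swap det_conj_mx pi pj.
exists d, a, b, c => z z' y; rewrite -(det_conj_mx p) -{1}pi -{1}pj conj_scale2 E.
by rewrite !mxE pi pj.
Qed.

(* Jacobi's identity for the complementary minors of [i] and [j]. *)
Lemma psum_disc n (X : 'M[K]_n) i j : 2%:R != 0 :> K -> i != j ->
  X^T = X -> psum (pswap i j) X != 0 ->
  (psum (phalf i j) X ^+ 2 - 4%:R * psum (pswap i j) X * psum (pnone i j) X) *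
    (X i i * X j j) =
  4%:R * X i j ^+ 2 * (psum (pfix i) X * psum (pfix j) X).
Proof.
move=> two0 ij sX /(det_scale2E ij sX)[d [p [q [r E]]]].
rewrite (psum_fixl _ ij) (psum_fixr _ ij) !E.
(* The values at 0, 1 and -1 determine the coefficients of the quadratic in [y], as 2 is
   invertible. *)
have F y := etrans (esym (det_scale_edge X y ij)) (E 1 1 y).
move: (F 0) (F 1) (F (-1)); set T2 := psum _ _; set T1 := psum _ _; set T0 := psum _ _.
move=> F0 F1 F2.
have T0E : T0 = d * ((X i i - p) * (X j j - r) - q ^+ 2) 
  by transitivity (T2 * 0 ^+ 2 + T1 * 0 + T0); [|rewrite F0]; ring.
have T1E : T1 = 2%:R * d * X i j * q.
  apply: (mulfI two0); transitivity
    (T2 * 1 ^+ 2 + T1 * 1 + T0 - (T2 * (-1) ^+ 2 + T1 * (-1) + T0)); first by ring.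
  by rewrite F1 F2; ring.
have T2E : T2 = - d * X i j ^+ 2.
  transitivity (T2 * 1 ^+ 2 + T1 * 1 + T0 - T1 - T0); first by ring.
  by rewrite F1 T1E T0E; ring.
by rewrite T0E T1E T2E; ring.
Qed.

End Schur.

(** * Tropically singular weights and their real lifts *)

Definition weight n (w : 'I_n -> 'I_n -> rat) (s : 'S_n) : rat := \sum_k w k (s k).

Section LeadPsum.
Variables (K : fieldType) (n : nat).

Lemma lead_at_sign (b : bool) : lead_at ((-1) ^+ b : puiseux K) 0 ((-1) ^+ b).
Proof. by case: b; rewrite ?expr1 ?expr0; [apply: lead_atN|]; exact: lead_at1. Qed.

Lemma lead_psum (S : pred 'S_n) (X : 'M[puiseux K]_n) w c (W : rat) :
  (forall k l, lead_at (X k l) (w k l) (c k l)) ->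
  (forall s, S s -> W <= weight w s) ->
  lead_at (psum S X) W
    (\sum_(s | S s && (weight w s == W)) (-1) ^+ s * \prod_k c k (s k)).
Proof.
move=> lX SW; rewrite big_mkcondr; apply: lead_at_sum => s /SW Ws.
have ls : lead_at ((-1) ^+ s * \prod_k X k (s k)) (weight w s)
    ((-1) ^+ s * \prod_k c k (s k)).
  rewrite -[weight w s]add0r; apply: lead_atM; first exact: lead_at_sign.
  by apply: lead_at_prod => k.
case: eqP => [<-//|/eqP sW]; apply: (lead_at_lt ls).
by rewrite lt_neqAle eq_sym sW.
Qed.

(** Otherwise all minimal permutations have the same edge counts, hence the same sign and the same
    product of leading coefficients, and [\det M] has as leading coefficient a positive multiple of
    a nonzero element, nonzero in characteristic 0. *)
Lemma tropically_singular (M : 'M[puiseux K]_n) (w := fun k l => pval (M k l)) :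
  (forall m, m.+1%:R != 0 :> K) ->
  M^T = M -> (forall k l, M k l != 0) -> \det M = 0 ->
  exists (i j : 'I_n) (s t : 'S_n), [/\ ecount s (edge i j) != ecount t (edge i j),
    forall r, weight w s <= weight w r & forall r, weight w t <= weight w r].
Proof.
move=> char0 sM M0 detM; pose c k l := M k l (pval (M k l)).
have cC k l : c k l = c l k.
  by rewrite /c; have -> : M k l = M l k by rewrite -{1}sM mxE.
have [s smin] : exists s, forall r, weight w s <= weight w r.
  exists [arg min_(r < (1%g : 'S_n)) weight w r]%O.
  by case: arg_minP => // s _ smin r; exact: smin.
apply: contrapT => none.
have same t : weight w t = weight w s -> ecount s =1 ecount t.
  move=> ts d; apply/eqP/negPn/negP => st; apply: none.
  (* A number counted differently by [s] and [t] is counted at least once, so it comes from an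
     actual edge. *)
  have [u [i ud]] : exists u : 'S_n, exists i, edge i (u i) = d.
    apply: contrapT => nou; move/eqP: st; apply.
    rewrite /ecount !big1// => k _; case: eqP => // e; exfalso; apply: nou.
      by exists t, k.
    by exists s, k.
  by exists i, (u i), s, t; rewrite ud; split=> // r; rewrite ts.
have := @lead_psum xpredT M w c (weight w s) (fun k l => lead_at_pval (M0 k l))
  (fun r _ => smin r).
have -> : psum xpredT M = 0 by rewrite -detM.
move=> /(lead_at_inj (lead_at0 _ _)) /esym /eqP.
rewrite (eq_bigr (fun=> (-1) ^+ s * \prod_k c k (s k))); last first.
  move=> t /eqP /same st; rewrite (prod_sym cC st).
  by rewrite (@odd_perm_ecount _ s t)// => [i j _|]; rewrite ?st//; apply: eq_bigr => i _.
rewrite sumr_const -mulr_natr mulf_eq0 mulf_eq0 signr_eq0 orFb.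
case/orP => [/prodf_eq0[k _]|]; first by have [/negPf] := pvalP (M0 k (s k)); rewrite /c => ->.
set m := #|_|; have : (0 < m)%N by apply/card_gt0P; exists s; rewrite unfold_in !eqxx.
by case: m => // m _; apply/negP; exact: char0.
Qed.

(** By Vieta's relations, roots of nonzero valuation force two of the coefficients to vanish: [c1]
    and [c2] if both valuations are negative, [c0] and [c2] if their signs differ, [c0] and [c1] if
    both are positive. *)
Lemma unit_root (T0 T1 T2 y1 y2 : puiseux K) (W : rat) c0 c1 c2 :
  lead_at T0 W c0 -> lead_at T1 W c1 -> lead_at T2 W c2 ->
  T1 = - (T2 * (y1 + y2)) -> T0 = T2 * y1 * y2 -> y1 != 0 -> y2 != 0 ->
  [|| (c0 != 0) && (c1 != 0), (c0 != 0) && (c2 != 0) | (c1 != 0) && (c2 != 0)] ->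
  pval y1 = 0 \/ pval y2 = 0.
Proof.
move=> l0 l1 l2; wlog le12 : y1 y2 / pval y1 <= pval y2.
  move=> wl e1 e0 n1 n2 nz; have [le|/ltW le] := leP (pval y1) (pval y2).
    exact: wl le e1 e0 n1 n2 nz.
  suff: pval y2 = 0 \/ pval y1 = 0 by case; [right|left].
  by apply: (wl _ _ le _ _ n2 n1 nz); rewrite ?e1 ?e0 1?addrC// mulrAC.
move=> e1 e0 n1 n2 nz; apply: contrapT => /not_orP[v1 v2].
have pos (y : puiseux K) : y != 0 -> 0 < pval y -> lead_at y 0 0.
  by move=> /lead_at_pval; exact: lead_at_lt.
have neg (y : puiseux K) : y != 0 -> pval y < 0 -> lead_at y^-1 0 0.
  move=> y0 yv; have := lead_atV (lead_at_pval y0) (pvalP y0).1.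
  by move=> /lead_at_lt; apply; rewrite oppr_gt0.
have mul0 (a b : puiseux K) c : lead_at a W c -> lead_at b 0 0 -> lead_at (a * b) W 0.
  by move=> la lb; rewrite -(addr0 W) -(mulr0 c); exact: lead_atM.
have {v1}[v1|v1] : pval y1 < 0 \/ 0 < pval y1 by apply/orP; rewrite -neq_lt; apply/eqP.
  have ly1 := neg _ n1 v1.
  have {v2}[v2|v2] : pval y2 < 0 \/ 0 < pval y2 by apply/orP; rewrite -neq_lt; apply/eqP.
    have ly2 := neg _ n2 v2.
    have E2 : T2 = T0 * y1^-1 * y2^-1 by rewrite e0; field; rewrite ?n1 ?n2.
    have E1 : T1 = - (T0 * y1^-1 + T0 * y2^-1) by rewrite e1 e0; field; rewrite ?n1 ?n2.
    have l01 := mul0 _ _ _ l0 ly1.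
    have z2 : c2 = 0.
      by apply: (lead_at_inj l2); rewrite E2; exact: mul0 l01 ly2.
    have z1 : c1 = 0.
      apply: (lead_at_inj l1); rewrite E1 -oppr0; apply: lead_atN.
      by rewrite -[X in lead_at _ _ X]addr0; apply: lead_atD l01 (mul0 _ _ _ l0 ly2).
    by move: nz; rewrite z1 z2 eqxx !andbF.
  have ly2 := pos _ n2 v2.
  have lu : lead_at (T2 * y1) W (- c1).
    have -> : T2 * y1 = - T1 - T2 * y2 by rewrite e1; ring.
    rewrite -[X in lead_at _ _ X]addr0 -oppr0; apply: lead_atD; first exact: lead_atN.
    by apply: lead_atN; exact: mul0 l2 ly2.
  have z2 : c2 = 0.
    by apply: (lead_at_inj l2); rewrite -[T2](mulfK n1); exact: mul0 lu ly1.
  have z0 : c0 = 0.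
    by apply: (lead_at_inj l0); rewrite e0; exact: mul0 lu ly2.
  by move: nz; rewrite z0 z2 eqxx /= andbF.
have v2' := lt_le_trans v1 le12.
have ly1 := pos _ n1 v1; have ly2 := pos _ n2 v2'.
have z0 : c0 = 0.
  by apply: (lead_at_inj l0); rewrite e0; exact: mul0 (mul0 _ _ _ l2 ly1) ly2.
have z1 : c1 = 0.
  apply: (lead_at_inj l1); rewrite e1 -oppr0; apply: lead_atN; apply: mul0 l2 _.
  by rewrite -[X in lead_at _ _ X]addr0; exact: lead_atD.
by move: nz; rewrite z0 z1 eqxx.
Qed.

End LeadPsum.

(** The parity is the sign of the leading coefficient of the discriminant when the entry on edge [c]
    is negated. If [s] and [t] have the same sign, a [c] that is no edge works. If they differ and
    every [c] failed, [s] and [t] would agree in parity on all edges off the diagonal and in their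
    number of fixed points, hence in sign. *)
Lemma sign_choice n (i j : 'I_n) (s t : 'S_n) : i != j -> s i = i -> t j = j ->
  exists c, odd (s + t + (ecount s c + ecount t c + (edge i i == c) + (edge j j == c)))
    = false.
Proof.
move=> ij si tj; pose f c := (ecount s c + ecount t c + (edge i i == c) + (edge j j == c))%N.
have [st|st] := eqVneq (odd_perm s) (odd_perm t).
  exists (n * n)%N; rewrite !ecount_big// !(ltn_eqF (edge_lt _ _)) !addn0 oddD !oddb st.
  by rewrite addbb.
apply: contrapT => /forallNP all1.
have feven c : odd (f c) = false.
  apply/negP => fc; apply: (all1 c); rewrite oddD -/(f c) fc oddD !oddb.
  by move: st; case: (odd_perm s); case: (odd_perm t).
have fdiag k : (s k == k) (+) (t k == k) (+) (k == i) (+) (k == j) = false.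
  by rewrite -(feven (edge k k)) /f !oddD !oddb !ecount_diag !oddb !edge_eq !andbb !orbb
     (eq_sym i) (eq_sym j).
have ji : j == i = false by rewrite eq_sym (negPf ij).
have ti : t i == i = false by have := fdiag i; rewrite si !eqxx (negPf ij); case: (t i == i).
have sj : s j == j = false by have := fdiag j; rewrite tj !eqxx ji; case: (s j == j).
case/eqP: st; apply: odd_perm_ecount => [k l kl|].
  have := feven (edge k l); rewrite /f !oddD !oddb !edge_eq.
  have kk m : (m == k) && (m == l) = false.
    by apply/negP => /andP[/eqP mk /eqP ml]; rewrite -mk -ml eqxx in kl.
  rewrite !kk ![_ && (_ == k)]andbC !kk !addbF => /eqP.
  by case: (odd _); case: (odd _).
(* Only [s] fixes [i] and only [t] fixes [j], so these two points balance; elsewhere the fixed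
   points coincide. *)
rewrite !(eq_bigr _ (fun k _ => ecount_diag _ k)) !(bigD1 i isT)/=.
rewrite !(bigD1 (P := fun k => k != i) j)/= ?ji// si tj ti sj !eqxx !add0n.
congr (_ + _)%N; apply: eq_bigr => k /andP[/negPf ki /negPf kj].
by have := fdiag k; rewrite ki kj !addbF; case: eqP; case: eqP.
Qed.

(** * Generic real matrices and their singular rescalings *)

Section Generic.
Variables (R : rcfType) (n : nat) (w : 'I_n -> 'I_n -> rat).
Hypothesis wC : forall k l, w k l = w l k.

Definition lambda : R := #|{: 'S_n}|.+1%:R.

Lemma lambda_gt0 : 0 < lambda. Proof. by rewrite ltr0n. Qed.

Definition gen_coef (c0 : nat) (k l : 'I_n) : R :=
  (-1) ^+ (edge k l == c0) * lambda ^+ (n.+1 ^ edge k l).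

(* Powers of a large number with exponents written in base [n.+1] keep
   different monomials from cancelling; [c0] is the edge whose sign is flipped. *)
Definition gen_mx (c0 : nat) : 'M[puiseux R]_n :=
  \matrix_(k, l) mono (gen_coef c0 k l) (w k l).

Lemma lead_gen_mx c0 k l : lead_at (gen_mx c0 k l) (w k l) (gen_coef c0 k l).
Proof. by rewrite mxE; exact: lead_at_mono. Qed.

Lemma gen_coef_neq0 c0 k l : gen_coef c0 k l != 0.
Proof. by rewrite mulf_neq0 ?signr_eq0// expf_neq0// gt_eqF// lambda_gt0. Qed.

Lemma gen_mx_sym c0 : (gen_mx c0)^T = gen_mx c0.
Proof. by apply/matrixP => k l; rewrite !mxE /gen_coef edgeC wC. Qed.

Lemma prod_gen_coef c0 (s : 'S_n) :
  \prod_k gen_coef c0 k (s k) = (-1) ^+ ecount s c0 * lambda ^+ theta s.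
Proof. by rewrite big_split /= !prodrXr. Qed.

(** Among the permutations of minimal weight in [S], one with maximal [theta] dominates: ties have
    equal edge counts, hence equal signs. It is chosen before [c0], so [c0] may later depend on
    it. *)
Lemma lead_gen (S : pred 'S_n) s0 : S s0 -> exists s, [/\ S s,
  forall t, S t -> weight w s <= weight w t &
  forall c0, exists v, lead_at (psum S (gen_mx c0)) (weight w s) v /\
    0 < (-1) ^+ s * (-1) ^+ ecount s c0 * v].
Proof.
move=> S0; pose W := weight w [arg min_(s < s0 | S s) weight w s]%O.
have [Wmin [s1 S1 W1]] : (forall t, S t -> W <= weight w t) /\
    exists2 s, S s & weight w s == W.
  rewrite /W; case: arg_minP => // s Ss smin; split=> [t /smin//|].
  by exists s.
pose P := [pred s | S s & weight w s == W].
have [s /andP[Ss /eqP sW] smax] : exists2 s, P s & forall t, P t -> (theta t <= theta s)%N.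
  have P1 : P s1 by rewrite /P /= S1.
  by case: (arg_maxnP (@theta n) P1) => s Ps smax; exists s.
exists s; split=> // [t /Wmin|c0]; first by rewrite sW.
pose e (t : 'S_n) : R := (-1) ^+ t * (-1) ^+ ecount t c0.
exists (\sum_(t | P t) e t * lambda ^+ theta t); split.
  have := @lead_psum _ _ S (gen_mx c0) w _ W (lead_gen_mx c0) Wmin.
  rewrite sW; congr lead_at; apply: eq_bigr => t _.
  by rewrite prod_gen_coef mulrA.
apply: (@dominant_sum _ _ P e) => //.
- by rewrite /= Ss sW eqxx.
- by move=> t; rewrite /e normrM !normr_sign mulr1.
- move=> t _ /theta_inj ts; rewrite /e ts.
  by rewrite (@odd_perm_ecount _ t s)// => [i j _|]; rewrite ?ts//; apply: eq_bigr => i _.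
Qed.

Lemma lead_gen_at (S : pred 'S_n) c0 W : (forall s, W <= weight w s) ->
  exists v, lead_at (psum S (gen_mx c0)) W v /\
    forall s, S s -> weight w s <= W -> v != 0.
Proof.
move=> Wmin; have [s0 S0|noS] := pickP S; last first.
  exists 0; split=> [|s]; last by rewrite noS.
  by rewrite /psum big_pred0//; exact: lead_at0.
have [s [Ss smin /(_ c0)[v [lv vpos]]]] := lead_gen S0.
have v0 : v != 0 by apply: contraTneq vpos => ->; rewrite mulr0 ltxx.
have [sW|Ws] := leP (weight w s) W.
  have -> : W = weight w s by apply/eqP; rewrite eq_le Wmin.
  by exists v.
(* Here all of [S] is heavier than [W], so the second clause is vacuous. *)
exists 0; split=> [|t /smin st tW]; first exact: lead_at_lt lv Ws.
by have := le_lt_trans tW (lt_le_trans Ws st); rewrite ltxx.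
Qed.

(** The determinant is affine in the factor [z] of the entry [(i, i)]. Through [s] and [t] both
    coefficients attain the minimal weight, so the solution has valuation 0. As [n * n] is no edge,
    no sign is flipped. *)
Lemma lift_diag i (s t : 'S_n) : s i = i -> t i != i ->
  (forall r, weight w s <= weight w r) -> (forall r, weight w t <= weight w r) ->
  exists Y : 'M[puiseux R]_n, [/\ Y^T = Y, \det Y = 0 &
    forall k l, exists2 c, c != 0 & lead_at (Y k l) (w k l) c].
Proof.
move=> si ti smin tmin; pose X := gen_mx (n * n).
have [v [lv /(_ s)]] := lead_gen_at (pfix i) (n * n) smin.
rewrite /pfix /= si eqxx => /(_ isT (lexx _)) v0.
have [u [lu /(_ t)]] := lead_gen_at (predC (pfix i)) (n * n) smin.
rewrite /pfix /= ti => /(_ isT (tmin _)) u0.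
pose z := - psum (predC (pfix i)) X / psum (pfix i) X.
have lz : lead_at z 0 (- u / v).
  by rewrite -(subrr (weight w s)); apply: lead_atM; [exact: lead_atN|exact: lead_atV].
exists (\matrix_(k, l) (X k l * (if (k == i) && (l == i) then z else 1))); split.
- apply/matrixP => k l; rewrite !mxE /gen_coef edgeC wC.
  by rewrite [(l == i) && _]andbC.
- by rewrite det_scale_diag mulrC divfK ?addNr// (lead_at_neq0 lv).
move=> k l; have lX := lead_gen_mx (n * n) k l; rewrite mxE -/X; case: ifP => _.
  exists (gen_coef (n * n) k l * (- u / v)).
    by rewrite mulf_neq0 ?gen_coef_neq0// mulf_neq0 ?oppr_eq0 ?invr_eq0.
  by rewrite -[w k l]addr0; exact: lead_atM.
by exists (gen_coef (n * n) k l); rewrite ?mulr1 ?gen_coef_neq0.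
Qed.

Lemma lift_off (i j : 'I_n) (s t : 'S_n) : i != j ->
  ecount s (edge i j) != ecount t (edge i j) ->
  (forall r, weight w s <= weight w r) -> (forall r, weight w t <= weight w r) ->
  exists Y : 'M[puiseux R]_n, [/\ Y^T = Y, \det Y = 0 &
    forall k l, exists2 c, c != 0 & lead_at (Y k l) (w k l) c].
Proof.
move=> ij st smin tmin.
(* [si] and [sj] carry the leading terms of the two minors in Jacobi's identity, and [c0] is chosen
   from their signs. *)
have [|si [/eqP sii _ leadi]] := @lead_gen (pfix i) 1%g; first by rewrite /pfix /= perm1.
have [|sj [/eqP sjj _ leadj]] := @lead_gen (pfix j) 1%g; first by rewrite /pfix /= perm1.
have [c0 sgn] := sign_choice ij sii sjj.
pose X := gen_mx c0; pose c := gen_coef c0.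
have {leadi}[vi [lvi vi0]] := leadi c0; have {leadj}[vj [lvj vj0]] := leadj c0.
have cN0 k l : c k l != 0 by exact: gen_coef_neq0.
have X0 k l : X k l != 0 by apply: lead_at_neq0 (lead_gen_mx c0 k l) (cN0 k l).
set T2 := psum (pswap i j) X; set T1 := psum (phalf i j) X; set T0 := psum (pnone i j) X.
have psum_neq0 (S : pred 'S_n) s0 : S s0 -> psum S X != 0.
  move=> /lead_gen[r [_ _ /(_ c0)[v [lv v0]]]]; apply: lead_at_neq0 lv _.
  by apply: contraTneq v0 => ->; rewrite mulr0 ltxx.
have T2N0 : T2 != 0 by apply: (@psum_neq0 _ (tperm i j)); rewrite /pswap /= tpermL tpermR !eqxx.
have T0N0 : T0 != 0 by apply: (@psum_neq0 _ 1%g); rewrite /pnone /= !perm1 ij eq_sym.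
have two0 : 2%:R != 0 :> puiseux R.
  by apply: (lead_at_neq0 (@lead_at_nat R 2)); rewrite pnatr_eq0.
have disc := psum_disc two0 ij (gen_mx_sym c0) T2N0; rewrite -/T2 -/T1 -/T0 -/X in disc.
(* Jacobi's identity gives the leading coefficient [v] of the discriminant; once positive, it is a
   square in the real closed field, and the discriminant is a square too. *)
have [d dE] : exists d, d ^+ 2 = T1 ^+ 2 - 4%:R * T2 * T0.
  have -> : T1 ^+ 2 - 4%:R * T2 * T0 = 4%:R * X i j ^+ 2 *
      (psum (pfix i) X * psum (pfix j) X) / (X i i * X j j).
    by rewrite -disc mulfK// mulf_neq0.
  have lX k l := lead_gen_mx c0 k l.
  have l4 : lead_at (4%:R * X i j ^+ 2) (w i j + w i j) (4%:R * c i j ^+ 2).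
    rewrite -[_ + _]add0r !expr2; apply: lead_atM; last exact: lead_atM.
    exact: lead_at_nat.
  have lD := lead_atM (lead_atM l4 (lead_atM lvi lvj))
    (lead_atV (lead_atM (lX i i) (lX j j)) (mulf_neq0 (cN0 i i) (cN0 j j))).
  set v := (X in lead_at _ _ X) in lD.
  have v0 : 0 < v.
    pose ei : R := (-1) ^+ si * (-1) ^+ ecount si c0.
    pose ej : R := (-1) ^+ sj * (-1) ^+ ecount sj c0.
    pose ai : R := (-1) ^+ (edge i i == c0); pose aj : R := (-1) ^+ (edge j j == c0).
    (* This parity from [sign_choice] lets [v] be rewritten with positive factors only. *)
    have eaE : ei * ej * ai * aj = 1.
      rewrite /ei /ej /ai /aj; transitivity ((-1) ^+ (si + sj + (ecount si c0 +
        ecount sj c0 + (edge i i == c0) + (edge j j == c0))) : R).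
        rewrite !exprD; move: ((-1) ^+ si) ((-1) ^+ sj) ((-1) ^+ ecount si c0)
          ((-1) ^+ ecount sj c0) ((-1) ^+ (edge i i == c0)) ((-1) ^+ (edge j j == c0)).
        by move=> x1 x2 x3 x4 x5 x6; ring.
      by rewrite -signr_odd sgn.
    pose Li : R := lambda ^+ (n.+1 ^ edge i i); pose Lj : R := lambda ^+ (n.+1 ^ edge j j).
    have Li0 : 0 < Li by rewrite exprn_gt0 ?lambda_gt0.
    have Lj0 : 0 < Lj by rewrite exprn_gt0 ?lambda_gt0.
    have -> : v = 4%:R * c i j ^+ 2 * ((ei * vi) * (ej * vj)) / (Li * Lj).
      apply: (mulIf (mulf_neq0 (cN0 i i) (cN0 j j))); rewrite /v divfK; last exact: mulf_neq0 (cN0 i i) (cN0 j j).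
      rewrite -[c i i]/(ai * Li) -[c j j]/(aj * Lj) -[LHS]mulr1 -eaE.
      by field; rewrite !gt_eqF.
    apply: divr_gt0; last exact: mulr_gt0.
    apply: mulr_gt0; last exact: mulr_gt0.
    apply: mulr_gt0; first by rewrite ltr0n.
    by rewrite exprn_even_gt0// orFb cN0.
  have vE : v = Num.sqrt v ^+ 2 by rewrite sqr_sqrtr// ltW.
  rewrite vE in lD; apply: (puiseux_sqrt _ _ lD); first by rewrite pnatr_eq0.
  by rewrite gt_eqF// sqrtr_gt0.
have twoT : 2%:R * T2 != 0 by rewrite mulf_neq0.
pose y1 := (- T1 + d) / (2%:R * T2); pose y2 := (- T1 - d) / (2%:R * T2).
have T1E : T1 = - (T2 * (y1 + y2)) by rewrite /y1 /y2; field; rewrite two0 T2N0.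
have T0E : T0 = T2 * y1 * y2.
  apply: (mulfI (mulf_neq0 twoT two0)).
  transitivity (T1 ^+ 2 - d ^+ 2); first by rewrite dE; ring.
  transitivity ((y1 * (2%:R * T2)) * (y2 * (2%:R * T2))); last by ring.
  by rewrite !divfK//; ring.
have y1N0 : y1 != 0 by apply: contraNneq T0N0 => y0; rewrite T0E y0 mulr0 mul0r.
have y2N0 : y2 != 0 by apply: contraNneq T0N0 => y0; rewrite T0E y0 mulr0.
have [v2 [lv2 v2P]] := lead_gen_at (pswap i j) c0 smin.
have [v1 [lv1 v1P]] := lead_gen_at (phalf i j) c0 smin.
have [v0 [lv0 v0P]] := lead_gen_at (pnone i j) c0 smin.
have [y [y0 yroot yv]] : exists y, [/\ y != 0,
    T2 * y ^+ 2 + T1 * y + T0 = 0 & pval y = 0].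
  have [|y1v|y2v] := unit_root lv0 lv1 lv2 T1E T0E y1N0 y2N0.
  (* [s] and [t] use the edge [{i, j}] different numbers of times, so they lie in different classes
     and make two of [v0], [v1], [v2] nonzero. *)
  - have A r : weight w r <= weight w s -> [&& pnone i j r ==> (v0 != 0),
        phalf i j r ==> (v1 != 0) & pswap i j r ==> (v2 != 0)].
      by move=> rs; apply/and3P; split; apply/implyP => Sr;
        [exact: v0P Sr rs|exact: v1P Sr rs|exact: v2P Sr rs].
    move: (A s (lexx _)) (A t (tmin s)) st.
    rewrite !ecount_off// /pnone /phalf /pswap /=.
    case: (s i == j); case: (s j == i); case: (t i == j); case: (t j == i) => //=;
      by case: (v0 == 0); case: (v1 == 0); case: (v2 == 0).
  - by exists y1; split=> //; rewrite T0E T1E; ring.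
  - by exists y2; split=> //; rewrite T0E T1E; ring.
exists (scale2 X i j 1 1 y); split.
- apply/matrixP => k l; rewrite !mxE /gen_coef edgeC wC; congr (_ * _).
  by case: (k == i); case: (l == i); case: (k == j); case: (l == j).
- by rewrite det_scale_edge.
move=> k l; have lX := lead_gen_mx c0 k l; rewrite mxE -/X.
have ly := lead_at_pval y0; rewrite yv in ly.
have [yN0 _] := pvalP y0; rewrite yv in yN0.
case: ifP => _; first by exists (c k l); rewrite ?mulr1.
case: ifP => _; first by exists (c k l); rewrite ?mulr1.
case: ifP => _; last by exists (c k l); rewrite ?mulr1.
exists (c k l * y 0); first by rewrite mulf_neq0.
by rewrite -[w k l]addr0; exact: lead_atM.
Qed.

End Generic.

Lemma real_lift (R : rcfType) (L : numFieldType) n (M : 'M[puiseux L]_n) :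
  M^T = M -> (forall k l, M k l != 0) -> \det M = 0 ->
  exists Y : 'M[puiseux R]_n, [/\ Y^T = Y, \det Y = 0 &
    forall k l, exists2 c, c != 0 & lead_at (Y k l) (pval (M k l)) c].
Proof.
move=> sM M0 detM; have [m|i [j [s [t [st smin tmin]]]]] := tropically_singular _ sM M0 detM.
  by rewrite pnatr_eq0.
have wC k l : pval (M k l) = pval (M l k) by rewrite -{1}sM mxE.
have [ij|ij] := eqVneq i j; last exact: lift_off wC _ _ _ _ ij st smin tmin.
(* A diagonal edge is used at most once, so exactly one of [s] and [t] fixes [i]. *)
move: st; rewrite -ij !ecount_diag; case: (s i =P i) => [si|/eqP si].
  by case: (t i =P i) => [//|/eqP ti] _; exact: (lift_diag _ wC si ti).
by case: (t i =P i) => [ti|//] _; exact: (lift_diag _ wC ti si).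
Qed.

Theorem theorem5p6 (R : realType) (n : nat) :
  trop (real_puiseux R) (singular_sym R n)
  = trop (complex_puiseux R) (singular_sym R n).
Proof.
(* The sets of valuation vectors agree already before taking closures. *)
suff E : ([set @pval_row R _ x | x in singular_sym R n `&` @torus_points R (real_puiseux R) _] =
    [set @pval_row R _ x | x in singular_sym R n `&` @torus_points R (complex_puiseux R) _])%classic.
  by rewrite /trop E.
apply/seteqP; split=> v [x [sx tx] <-].
  by exists x => //; split=> // i; split=> //; have [] := tx i.
case: sx => M [sM detM] Mx.
have M0 k l : M k l != 0.
  (* The torus condition only sees the entries on and above the diagonal; symmetry covers the
     others. *)
  wlog kl : k l / (k <= l)%N => [wl|].
    have [/wl//|/ltnW/wl] := leqP k l.
    by rewrite -{2}sM mxE.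
  have /= kl' : (k, l) \in upper n by [].
  have [_] := tx (enum_rank_in kl' (k, l)).
  by rewrite -Mx mxE enum_rankK_in.
have [Y [sY detY leadY]] := real_lift R sM M0 detM.
pose f := map_puiseux (real_complex R).
have leadfY k l : exists2 c, c != 0 & lead_at (f (Y k l)) (pval (M k l)) c.
  have [c c0 /(lead_at_map (real_complex R)) lc] := leadY k l.
  by exists (real_complex R c); rewrite ?fmorph_eq0.
exists (sym_coords (map_mx f Y)).
  split; first exists (map_mx f Y) => //.
    by split; [rewrite map_trmx sY|rewrite det_map_mx detY rmorph0].
  move=> i; rewrite mxE mxE; have [c c0 /lead_at_neq0 Y0] := leadfY (enum_val i).1 (enum_val i).2.
  by split; [exists (Y (enum_val i).1 (enum_val i).2)|exact: Y0].
apply/rowP => i; rewrite -Mx !mxE.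
have [c c0 /lead_at_val] := leadfY (enum_val i).1 (enum_val i).2.
by move=> /(_ c0) ->.
Qed.
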